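(* Let $K$ be a field, let $m,n\ge 1$ be integers, and let $f(X,Y)=a_0+a_1Y+\cdots+a_mY^m$ and $g(X,Y)=b_0+b_1Y+\cdots+b_nY^n$, with $a_0,a_1,\ldots,a_m,b_0,b_1,\ldots,b_n\in K[X]$ and $a_0a_mb_n\neq 0$. If $a_m=pq$ with $p,q\in K[X]$, $p$ irreducible over $K$, and $$\deg p>\max\{(m-1)\deg q,\ (n-1)\deg q+mn\deg b_n\}+H_1(f),$$ then the polynomial $f(X,g(X,Y))$ is irreducible over $K(X)$.
   Context: For $f=a_0(X)+a_1(X)Y+\cdots+a_m(X)Y^m\in K[X,Y]$ with $a_m\ne 0$, $H_1(f)=\max\{\deg a_0,\ldots,\deg a_{m-1}\}$, where $\deg$ is the degree in $X$ (zero coefficients are ignored in the maximum, i.e. $\deg 0=-\infty$). ''Irreducible over $K(X)$'' means irreducible in the ring $K(X)[Y]$. *)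

(* Defs.v *)
From HB Require Import structures.
From mathcomp Require Import all_boot all_order all_algebra.

Set Implicit Arguments.
Unset Strict Implicit.
Unset Printing Implicit Defensive.

Import GRing.Theory.
Local Open Scope ring_scope.

(* K[X, Y] is represented as {poly {poly K}}: the outer variable is Y and the
   coefficients are polynomials in X. *)

(* Natural-number degree; it agrees with the usual one on nonzero polynomials
   (the convention deg 0 = -oo is not encoded, pdeg 0 = 0). *)
Definition pdeg (K : fieldType) (p : {poly K}) : nat := (size p).-1.

(* The maximum of deg a_i over the nonleading coefficients of f.  Zero
   coefficients are skipped; an empty maximum is 0 instead of -oo, which cannot
   occur as soon as the constant coefficient is nonzero and deg_Y f >= 1. *)
Definition H1 (K : fieldType) (f : {poly {poly K}}) : nat :=
  \max_(i < (size f).-1 | f`_i != 0) pdeg f`_i.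

Definition irreducible_over_KX (K : fieldType) (f : {poly {poly K}}) : Prop :=
  irreducible_poly (map_poly (@tofrac {poly K}) f).

(* Main.v *)
Require Import Defs.
From HB Require Import structures.
From mathcomp Require Import all_boot all_order all_algebra.
From mathcomp Require Import zify.
From Stdlib Require Import Classical_Prop.

(** The proof works with two valuations of K(X): first the degree, to show that
f is irreducible, and then the p-adic one, to pass from f to f(X, g).

- The polynomial f is irreducible ([irreducible_of_large_lead_coef]).  Let
  f = A * B in K[X][Y] with p dividing the leading coefficient of A, so that
  the leading coefficient t of B divides q.  Put
  e = deg p + deg q - H_1(f).  Since deg a_i <= H_1(f) = deg a_m - e for i < m,
  the Newton polygon of f for the degree valuation lies under the line of
  slope e / m through its last vertex (m, deg a_m).  The same then holds for
  the factor B ([newton_slope]), and its constant coefficient, which is nonzero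
  and so has degree at least 0, gives e * deg_Y B <= m * deg t <= m * deg q.
  If deg_Y B >= 1, this says deg p <= (m - 1) * deg q + H_1(f), which is
  excluded.

- Every nonconstant factor B of f(X, g) has a leading coefficient divisible by p
  ([lead_coef_dvd_of_comp_factor]).  Suppose p does not divide t = lc(B), and
  let y be the class of Y modulo B.  Then y, hence g(y), is integral over
  K[X][1/t]: there is h in K[X][Z] whose leading coefficient is a power of t and
  such that h(g(y)) = 0 ([integral_relation]).  Now f is irreducible and
  f(g(y)) = 0, so f divides h over K(X).  By the Gauss lemma ([gauss_factor])
  f = c * f_1 with lc(f_1) dividing lc(h), hence prime to p.  But p divides
  a_m = c * lc(f_1), so p divides c and therefore a_0, which is impossible as
  a_0 is nonzero of degree at most H_1(f) < deg p.

- Hence if f(X, g) had two nonconstant factors, p^2 would divide its leading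
  coefficient p * q * b_n^m.  This is impossible because deg q < deg p and
  deg b_n < deg p; the first inequality can only fail for m = n = 1, when
  f(X, g) has degree 1 in Y.

Irreducibility over K(X) is handled without leaving K[X][Y]: over an integral
domain, divisibility of polynomials is pseudo-divisibility, which is
divisibility over the fraction field ([irreducible_over_fractions]). *)

Set Implicit Arguments.
Unset Strict Implicit.
Unset Printing Implicit Defensive.

Import GRing.Theory.
Local Open Scope ring_scope.

(** * The Gauss lemma and irreducibility over the fraction field *)

(** Isolates the term that dominates the coefficient of a product, both in the
Gauss lemma and in the Newton polygon argument. *)
Lemma coefM_split (R : nzRingType) (A B : {poly R}) (i j : nat) :
  (A * B)`_(i + j) =
    A`_i * B`_j + \sum_(k < (i + j).+1 | k != i :> nat) A`_k * B`_(i + j - k).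
Proof.
have lt_i : (i < (i + j).+1)%N by rewrite ltnS leq_addr.
by rewrite coefM (bigD1 (Ordinal lt_i)) //= addKn.
Qed.

Lemma exists_irreducible_factor (K : fieldType) (c : {poly K}) :
  (1 < size c)%N -> exists2 r, irreducible_poly r & r %| c.
Proof.
have [n] := ubnP (size c); elim: n => // n IHn in c *.
rewrite ltnS => le_cn c_gt1.
have [[d /and3P[d_neq1 d_c d_neqc]]|no_d] :=
    classic (exists d : {poly K}, [&& size d != 1%N, d %| c & ~~ (d %= c)]).
  have c0 : c != 0 by rewrite -size_poly_gt0 ltnW.
  have d0 : d != 0 by apply: contraNneq c0 => d0; move: d_c; rewrite d0 dvd0p.
  have lt_dc : (size d < size c)%N.
    by rewrite ltn_neqAle (dvdp_size_eqp d_c) d_neqc dvdp_leq.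
  have [||r r_irr r_d] := IHn d; first exact: leq_trans lt_dc le_cn.
    by rewrite ltn_neqAle eq_sym d_neq1 size_poly_gt0.
  by exists r => //; apply: dvdp_trans d_c.
exists c => //; split=> // d d_neq1 d_c; apply/negPn/negP => d_neqc.
by apply: no_d; exists d; rewrite d_neq1 d_c.
Qed.

Lemma irreducible_dvdpM (K : fieldType) (r a b : {poly K}) :
  irreducible_poly r -> r %| a * b -> (r %| a) || (r %| b).
Proof.
move=> r_irr r_ab; have [//|r_a /=] := boolP (r %| a).
by rewrite -(@Gauss_dvdpr _ _ a) // irreducible_poly_coprime.
Qed.

(** An irreducible r of K[X] stays prime in K[X][Y]: if i and j are the least
indices with r dividing neither A_i nor B_j, then A_i * B_j is the only term of
the coefficient of index i + j that r does not divide. *)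
Lemma dvdp_contentM (K : fieldType) (r : {poly K}) (A B : {poly {poly K}}) :
    irreducible_poly r -> (forall i, r %| (A * B)`_i) ->
  (forall i, r %| A`_i) \/ (forall j, r %| B`_j).
Proof.
move=> r_irr r_AB.
have [exA|noA] := classic (exists i, ~~ (r %| A`_i)); last first.
  by left=> i; apply/negPn/negP => Ai; apply: noA; exists i.
have [exB|noB] := classic (exists j, ~~ (r %| B`_j)); last first.
  by right=> j; apply/negPn/negP => Bj; apply: noB; exists j.
have [i Ai min_i] := ex_minnP exA.
have [j Bj min_j] := ex_minnP exB.
have := r_AB (i + j)%N; rewrite coefM_split dvdp_addl.
  by move/(irreducible_dvdpM r_irr); rewrite (negPf Ai) (negPf Bj).
apply: (big_ind (fun x => r %| x)) => [|x y|k neq_ki].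
- exact: dvdp0.
- exact: dvdp_add.
- have [lt_ki|lt_ik|eq_ki] := ltngtP (k : nat) i; last first.
  - by rewrite eq_ki eqxx in neq_ki.
  - apply/dvdp_mull/negPn/negP => /min_j.
    by have := ltn_ord k; move: lt_ik; lia.
  - by apply/dvdp_mulr/negPn/negP => /min_i; rewrite leqNgt lt_ki.
Qed.

Lemma divide_content (K : fieldType) (r : {poly K}) (A : {poly {poly K}}) :
  (forall i, r %| A`_i) -> exists A1, A = r *: A1.
Proof.
move=> rA; exists (\poly_(i < size A) (A`_i %/ r)).
apply/polyP => i; rewrite coefZ coef_poly; case: ltnP => [_|/leq_sizeP->//].
  by rewrite mulrC divpK.
by rewrite mulr0.
Qed.

(** The Gauss lemma, by removing the irreducible factors of c one at a time:
each divides all coefficients of A or all coefficients of B.  The constants c1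
and c2 of K[X] collect the factors taken from A and from B. *)
Lemma gauss_factor (K : fieldType) (c : {poly K}) (F A B : {poly {poly K}}) :
    c != 0 -> c *: F = A * B ->
  exists c1 c2 (A1 B1 : {poly {poly K}}),
    [/\ A = c1 *: A1, B = c2 *: B1 & F = A1 * B1].
Proof.
have [n] := ubnP (size c); elim: n => // n IHn in c A B *.
rewrite ltnS => le_cn c0 cF.
have [c_gt1|c_le1] := ltnP 1 (size c); last first.
  have /size_poly1P[x x0 def_c] : size c == 1%N.
    by rewrite eqn_leq c_le1 size_poly_gt0.
  exists 1, c, A, (x^-1%:P *: B); split; first by rewrite scale1r.
    by rewrite scalerA def_c -polyCM mulfV // scale1r.
  by rewrite -scalerAr -cF scalerA def_c -polyCM mulVf // scale1r.
have [r r_irr /dvdpP[d def_c]] := exists_irreducible_factor c_gt1.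
have r0 := irredp_neq0 r_irr.
have d0 : d != 0 by apply: contraNneq c0 => d0; rewrite def_c d0 mul0r.
have lt_dn : (size d < n)%N.
  apply: leq_trans le_cn; rewrite def_c size_mul //.
  have d_gt0 : (0 < size d)%N by rewrite size_poly_gt0.
  have r_gt1 : (1 < size r)%N by case: r_irr.
  by move: (size d) (size r) d_gt0 r_gt1 => x y; lia.
have r_inj : injective ( *:%R r : {poly {poly K}} -> _).
  by move=> P Q; rewrite -!mul_polyC; apply: mulfI; rewrite polyC_eq0.
have [i|rA|rB] := @dvdp_contentM _ r A B r_irr.
- by rewrite -cF coefZ def_c -mulrA mulrCA dvdp_mulIl.
- have [A' defA] := divide_content rA.
  have [|c1 [c2 [A1 [B1 [defA' defB defF]]]]] := IHn d A' B lt_dn d0.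
    by apply: r_inj; rewrite scalerA mulrC -def_c cF defA scalerAl.
  by exists (r * c1), c2, A1, B1; split; rewrite // defA defA' scalerA.
- have [B' defB] := divide_content rB.
  have [|c1 [c2 [A1 [B1 [defA defB' defF]]]]] := IHn d A B' lt_dn d0.
    by apply: r_inj; rewrite scalerA mulrC -def_c cF defB scalerAr.
  by exists c1, (r * c2), A1, B1; split; rewrite // defB defB' scalerA.
Qed.

Lemma irreducible_of_no_factor (K : fieldType) (F : {poly {poly K}}) :
    (1 < size F)%N ->
    (forall A B, F = A * B -> (size A <= 1)%N \/ (size B <= 1)%N) ->
  irreducible_poly F.
Proof.
move=> F_gt1 noF; split=> // A A_neq1 /[dup] A_F.
case/Pdiv.Idomain.dvdpP=> -[c B] /= c0 cF.
have F0 : F != 0 by rewrite -size_poly_gt0 ltnW.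
have [c1 [c2 [B1 [A1 [defB defA defF]]]]] := gauss_factor c0 cF.
have: B * A != 0 by rewrite -cF -mul_polyC mulf_neq0 ?polyC_eq0.
rewrite mulf_eq0 negb_or => /andP[B0 A0].
have c1_0 : c1 != 0 by apply: contraNneq B0 => z; rewrite defB z scale0r.
have c2_0 : c2 != 0 by apply: contraNneq A0 => z; rewrite defA z scale0r.
have sA : size A = size A1 by rewrite defA size_scale.
have sB : size B = size B1 by rewrite defB size_scale.
rewrite -(dvdp_size_eqp A_F); apply/eqP.
have: size (c *: F) = (size B + size A).-1 by rewrite cF size_mul.
rewrite size_scale //; move: (noF _ _ defF); rewrite -sA -sB => sAB.
have A_gt0 : (0 < size A)%N by rewrite size_poly_gt0.
have B_gt0 : (0 < size B)%N by rewrite size_poly_gt0.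
by move/eqP: A_neq1 A_gt0 B_gt0; lia.
Qed.

Lemma fraction_numden (R : idomainType) (x : {fraction R}) :
  exists a b : R, b != 0 /\ tofrac b * x = tofrac a.
Proof.
elim/quotW: x => -[[a b] /= b0]; exists a, b; split=> //.
unlock tofrac; rewrite -[LHS]FracField.pi_mul.
apply/eqP; rewrite FracField.equivf_def /FracField.mulf.
rewrite !numden_Ratio ?mulf_neq0 ?oner_eq0 //= ?oner_eq0 //.
by rewrite !mul1r mulr1 mulrC.
Qed.

Lemma clear_denominators (R : idomainType) (Q : {poly {fraction R}}) :
  exists d (A : {poly R}), d != 0 /\ tofrac d *: Q = map_poly (@tofrac R) A.
Proof.
elim/poly_ind: Q => [|Q x [d [A [d0 dQ]]]].
  by exists 1, 0; rewrite oner_neq0 scaler0 rmorph0.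
have [a [b [b0 def_x]]] := fraction_numden x.
exists (d * b), (b *: A * 'X + (d * a)%:P); rewrite mulf_neq0 //; split=> //.
rewrite [RHS]rmorphD /= [X in _ = X + _]rmorphM /= map_polyX map_polyC.
rewrite map_polyZ /= -dQ !rmorphM /=.
rewrite scalerDr scalerA -scalerAl [tofrac b * _]mulrC; congr (_ + _).
by rewrite -def_x -mul_polyC -!polyCM mulrA.
Qed.

(** Clearing denominators turns a divisor of F over K(X) into a pseudo-divisor
of F with coefficients in K[X]. *)
Lemma irreducible_over_fractions (K : fieldType) (F : {poly {poly K}}) :
  irreducible_poly F -> irreducible_over_KX F.
Proof.
case=> F_gt1 irrF; set iota := map_poly (@tofrac {poly K}).
have iota_inj : injective iota.
  apply: map_inj_poly => [x y /eqP|]; first by rewrite tofrac_eq => /eqP.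
  exact: rmorph0.
have size_iota G : size (iota G) = size G.
  apply: size_map_inj_poly => [x y /eqP|]; first by rewrite tofrac_eq => /eqP.
  exact: rmorph0.
split=> [|Q Q_neq1 /dvdpP[Q' defF]]; first by rewrite size_iota.
have [d [A [d0 dQ]]] := clear_denominators Q.
have [d' [A' [d'0 dQ']]] := clear_denominators Q'.
have fd0 : tofrac d != 0 by rewrite tofrac_eq0.
have : A %= F.
  apply: irrF; first by rewrite -size_iota /iota -dQ size_scale ?tofrac_eq0 .
  apply/Pdiv.Idomain.dvdpP; exists (d' * d, A'); first by rewrite mulf_neq0.
  apply: iota_inj; rewrite /= /iota map_polyZ !rmorphM /= -dQ -dQ' defF.
  by rewrite -scalerAl -scalerAr scalerA.
case/eqpP=> -[c1 c2] /= /andP[c1_0 c2_0] eqAF; apply/eqpP.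
exists (tofrac (c1 * d), tofrac c2); first by rewrite !tofrac_eq0 mulf_neq0.
by rewrite /= rmorphM -scalerA dQ -!map_polyZ eqAF; exact: erefl.
Qed.

(** * The Newton polygon for the degree valuation *)

Lemma pdegM (K : fieldType) (a b : {poly K}) :
  a != 0 -> b != 0 -> pdeg (a * b) = (pdeg a + pdeg b)%N.
Proof.
move=> a0 b0; rewrite /pdeg size_mul //.
have := size_poly_gt0 a; have := size_poly_gt0 b; rewrite a0 b0.
by move: (size a) (size b) => x y; lia.
Qed.

(** The lexicographic choice, largest weight and then least index, is a single
maximization: the weight is scaled so that any gain beats every index. *)
Lemma first_maximum (P : pred nat) (w : nat -> nat) (N : nat) :
    (exists i, P i) -> (forall i, P i -> (i <= N)%N) ->
  exists i, [/\ P i, (forall k, P k -> (w k <= w i)%N)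
    & (forall k, P k -> (k < i)%N -> (w k < w i)%N)].
Proof.
move=> [i0 Pi0] leN; have i0N : (i0 < N.+1)%N by rewrite ltnS leN.
pose v k := (w k * N.+1 + (N - k))%N.
have [i Pi max_i] := @arg_maxnP _ (Ordinal i0N) (fun i : 'I_N.+1 => P i)
  (fun i : 'I_N.+1 => v i) Pi0.
have {}max_i k : P k -> (v k <= v i)%N.
  move=> Pk; have kN : (k < N.+1)%N by rewrite ltnS leN.
  exact: (max_i (Ordinal kN)).
have iN : (i <= N)%N by rewrite -ltnS ltn_ord.
exists i; split=> // k Pk => [|lt_ki]; move/max_i: (Pk); rewrite /v;
  by have := leN k Pk; nia.
Qed.

(** Weight f_k by mu * deg f_k - e * k.  Maximal weights are additive in
products (look at the first indices attaining them in A and in B), and the hypothesis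
makes f attain its maximum at the leading coefficient; hence so does B.  The
bound compares that maximum with the weight of B_0, which is at least 0. *)
Lemma newton_slope (K : fieldType) (mu e : nat) (f A B : {poly {poly K}}) :
    f = A * B -> f`_0 != 0 ->
    (forall k, f`_k != 0 ->
      (mu * pdeg f`_k + e * ((size f).-1 - k) <= mu * pdeg (lead_coef f))%N) ->
  (e * (size B).-1 <= mu * pdeg (lead_coef B))%N.
Proof.
move=> defF f0 le_f; set m := (size f).-1.
have : f != 0 by apply: contraNneq f0 => ->; rewrite coef0.
rewrite defF mulf_eq0 negb_or => /andP[A0 B0].
have [A00 B00] : A`_0 != 0 /\ B`_0 != 0.
  by move: f0; rewrite defF coef0M mulf_eq0 negb_or => /andP.
have sA : (0 < size A)%N by rewrite size_poly_gt0.
have sB : (0 < size B)%N by rewrite size_poly_gt0.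
have def_m : m = ((size A).-1 + (size B).-1)%N.
  by rewrite /m defF size_mul //; move: (size A) (size B) sA sB => x y; lia.
(* Shifted by e * m, the weights stay in nat. *)
pose w (C : {poly {poly K}}) i := (mu * pdeg C`_i + e * (m - i))%N.
have supp (C : {poly {poly K}}) i : C`_i != 0 -> (i <= (size C).-1)%N.
  move=> Ci; rewrite -ltnS (leq_trans _ (leqSpred _)) // ltnNge.
  by apply: contra Ci => /leq_sizeP->.
have [i [Ai max_i lt_i]] :=
  first_maximum (w A) (ex_intro (fun i => A`_i != 0) 0%N A00) (supp A).
have [j [Bj max_j lt_j]] :=
  first_maximum (w B) (ex_intro (fun i => B`_i != 0) 0%N B00) (supp B).
have le_iA := supp _ _ Ai; have le_jB := supp _ _ Bj.
(* Every other term of this coefficient has a strictly smaller weight, hence a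
   strictly smaller degree. *)
have size_ij : size f`_(i + j) = size (A`_i * B`_j).
  rewrite defF coefM_split size_polyDl //.
  have AB_gt0 : (0 < size (A`_i * B`_j)%R)%N by rewrite size_poly_gt0 mulf_neq0.
  apply: (big_ind (fun x : {poly K} => (size x < size (A`_i * B`_j)%R)%N)).
  - by rewrite size_poly0.
  - by move=> x y sx sy; rewrite (leq_ltn_trans (size_polyD _ _)) // gtn_max sx.
  move=> k neq_ki.
  have [->|Ak] := eqVneq A`_k 0; first by rewrite mul0r size_poly0.
  have [->|Bl] := eqVneq B`_(i + j - k) 0; first by rewrite mulr0 size_poly0.
  have lt_deg : (pdeg (A`_k * B`_(i + j - k)) < pdeg (A`_i * B`_j))%N.
    have := ltn_ord k; rewrite ltnS => le_kij.
    have: (w A k + w B (i + j - k) < w A i + w B j)%N.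
      have [lt_ki|lt_ik|eq_ki] := ltngtP (k : nat) i.
      - by rewrite -addSn leq_add ?lt_i ?max_j.
      - by rewrite -addnS leq_add ?max_i ?lt_j //; move: lt_ik le_kij; lia.
      - by rewrite eq_ki eqxx in neq_ki.
    have le_kA := supp _ _ Ak; have le_lB := supp _ _ Bl.
    have -> : (w A k + w B (i + j - k) =
        mu * pdeg (A`_k * B`_(i + j - k))
          + e * ((m - k) + (m - (i + j - k))))%N.
      by rewrite pdegM // /w !mulnDr addnACA.
    have -> : (w A i + w B j =
        mu * pdeg (A`_i * B`_j) + e * ((m - i) + (m - j)))%N.
      by rewrite pdegM // /w !mulnDr addnACA.
    have -> : ((m - k) + (m - (i + j - k)) = (m - i) + (m - j))%N.
      by move: le_kA le_lB le_iA le_jB le_kij; rewrite def_m; lia.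
    by rewrite ltn_add2r ltn_mul2l => /andP[].
  move: lt_deg AB_gt0; rewrite /pdeg.
  by move: (size _) (size _) => x y; lia.
have fij : f`_(i + j) != 0.
  by rewrite -size_poly_gt0 size_ij size_poly_gt0 mulf_neq0.
have := le_f _ fij; have -> : pdeg f`_(i + j) = (pdeg A`_i + pdeg B`_j)%N.
  by rewrite /pdeg size_ij -/(pdeg _) pdegM.
rewrite -/m {1}defF lead_coefM pdegM ?lead_coef_eq0 //.
have := max_i (size A).-1; rewrite -lead_coefE lead_coef_eq0 => /(_ A0).
have := max_j 0%N B00; rewrite /w def_m -lead_coefE.
rewrite !mulnBr !mulnDr !muln0 !subn0.
have := leq_mul (leqnn e) le_iA; have := leq_mul (leqnn e) le_jB.
move: (mu * pdeg B`_0)%N (mu * pdeg B`_j)%N (mu * pdeg A`_i)%N.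
move: (e * i)%N (e * j)%N.
move: (mu * pdeg (lead_coef A))%N (mu * pdeg (lead_coef B))%N.
move: (e * (size A).-1)%N (e * (size B).-1)%N; lia.
Qed.

(** The slope is e / m with e = deg p + deg q - H_1(f), the drop in degree from
the leading coefficient to the other ones. *)
Lemma irreducible_of_large_lead_coef (K : fieldType) (f : {poly {poly K}})
    (p q : {poly K}) :
    irreducible_poly p -> lead_coef f = p * q -> f`_0 != 0 -> (1 < size f)%N ->
    (((size f).-1 - 1) * pdeg q + H1 f < pdeg p)%N ->
  irreducible_poly f.
Proof.
move=> p_irr lead_f f0 f_gt1 hdeg.
have p0 := irredp_neq0 p_irr.
have f_neq0 : f != 0 by rewrite -size_poly_gt0 ltnW.
have q0 : q != 0.
  by apply: contraNneq f_neq0 => q0; rewrite -lead_coef_eq0 lead_f q0 mulr0.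
have main A B : f = A * B -> p %| lead_coef A -> (size B <= 1)%N.
  move=> def_f /dvdpP[x lead_A].
  have def_q : q = x * lead_coef B.
    by apply: (mulfI p0); rewrite -lead_f def_f lead_coefM lead_A mulrCA mulrA.
  have le_lB : (pdeg (lead_coef B) <= pdeg q)%N.
    move: q0; rewrite def_q mulf_eq0 negb_or => /andP[x0 lB0].
    by rewrite pdegM // leq_addl.
  set m := (size f).-1 in hdeg *.
  have m_gt0 : (0 < m)%N by rewrite /m; move: (size f) f_gt1 => [|[]].
  pose e := (pdeg p + pdeg q - H1 f)%N.
  have slope k : f`_k != 0 ->
      (m * pdeg f`_k + e * (m - k) <= m * pdeg (lead_coef f))%N.
    move=> fk; rewrite lead_f pdegM //.
    have [lt_km|le_mk] := ltnP k m; last first.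
      have -> : k = m.
        apply/eqP; rewrite eqn_leq le_mk andbT -ltnS prednK ?size_poly_gt0 //.
        by rewrite ltnNge; apply: contra fk => /leq_sizeP->.
      by rewrite subnn muln0 addn0 -lead_coefE lead_f pdegM.
    have le_H1 : (pdeg f`_k <= H1 f)%N.
      by rewrite /H1 (bigD1 (Ordinal lt_km)) //= leq_maxl.
    apply: (@leq_trans (m * H1 f + e * m)%N).
      by rewrite leq_add // leq_mul ?leq_subr.
    rewrite [(e * m)%N]mulnC -mulnDr leq_mul // /e.
    by move: (leq_ltn_trans (leq_addl _ _) hdeg); lia.
  have := newton_slope def_f f0 slope.
  rewrite leqNgt => le_e; apply/negP => B_gt1; move/negP: le_e; apply.
  apply: (@leq_ltn_trans (m * pdeg q)%N); first by rewrite leq_mul.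
  apply: (@leq_trans e); last first.
    by rewrite leq_pmulr //; move: (size B) B_gt1 => [|[]].
  rewrite /e; move: hdeg; rewrite -{2}(prednK m_gt0) mulSn -subn1.
  by move: (_ * _)%N; lia.
apply: irreducible_of_no_factor => // A B def_f.
have: p %| lead_coef A * lead_coef B.
  by rewrite -lead_coefM -def_f lead_f dvdp_mulIl.
case/(irreducible_dvdpM p_irr)/orP => [pA|pB]; first by right; apply: main pA.
by left; apply: (main B A) => //; rewrite mulrC.
Qed.

(** * Factors of a composition *)

(** The determinant trick.  Let d = deg B and t = lc(B).  Multiplication by
t^k g on the powers 1, Y, ..., Y^(d-1) modulo B has a matrix G with entries in
R as soon as k is large enough for all the pseudo-divisions by B.  The
characteristic polynomial of G therefore kills t^k g modulo B; substituting
t^k Z for its variable makes its leading coefficient a power of t. *)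
Lemma integral_relation (R : idomainType) (B g : {poly R}) :
    (1 < size B)%N ->
  exists (h : {poly R}) k, lead_coef h = lead_coef B ^+ k /\ B %| h \Po g.
Proof.
move=> B_gt1; have [s def_s] : exists s, size B = s.+2.
  by exists (size B).-2; move: B_gt1; case: (size B) => [|[]].
have B0 : B != 0 by rewrite -size_poly_gt0 def_s.
set t := lead_coef B; have t0 : t != 0 by rewrite lead_coef_eq0.
pose y (i : 'I_s.+1) := 'X^i * g.
pose k := (\sum_(i < s.+1) scalp (y i) B)%N.
have le_k i : (scalp (y i) B <= k)%N by rewrite /k (bigD1 i) //= leq_addr.
pose c i := t ^+ (k - scalp (y i) B).
pose G := \matrix_(i, j < s.+1) (c i *: (y i %% B))`_j.
pose z := t ^+ k *: g.
pose N := map_mx (comp_poly z) (char_poly_mx G).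
pose v : 'cV[{poly R}]_s.+1 := \col_j 'X^j.
(* N represents t^k g - G on the powers of Y, and it kills them modulo B. *)
have def_Nv : N *m v = B *: \col_i (c i *: (y i %/ B)).
  apply/colP => i; rewrite [LHS]mxE [RHS]mxE [in RHS]mxE.
  have -> : \sum_j N i j * v j 0 = z * 'X^i - c i *: (y i %% B).
    under eq_bigr => j _.
      rewrite !mxE comp_polyB comp_polyC raddfMn /= comp_polyX mulrBl.
      over.
    rewrite sumrB (bigD1 i) //= eqxx big1 => [|j neq_ji]; last first.
      by rewrite eq_sym (negPf neq_ji) mul0r.
    rewrite addr0; congr (_ - _); apply/polyP=> l; rewrite coef_sum.
    under eq_bigr => j _ do rewrite coefCM coefXn.
    have [lt_l|le_l] := ltnP l s.+1; last first.
      rewrite big1 => [|j _]; last first.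
        by rewrite gtn_eqF ?mulr0 // (leq_trans (ltn_ord j)).
      apply/esym; move: l le_l; apply/leq_sizeP; rewrite -ltnS.
      apply: leq_ltn_trans (size_scale_leq _ _) _.
      by rewrite -def_s ltn_modp.
    rewrite (bigD1 (Ordinal lt_l)) //= eqxx mulr1 big1 ?addr0 // => j neq_jl.
    by rewrite -val_eqE /= eq_sym in neq_jl; rewrite (negPf neq_jl) mulr0.
  have -> : z * 'X^i = c i *: (t ^+ scalp (y i) B *: y i).
    by rewrite scalerA -exprD subnK // /z -scalerAl mulrC.
  by rewrite Pdiv.Idomain.divp_eq scalerDr addrK scalerAl mulrC.
have def_h : (char_poly G \Po (t ^+ k *: 'X)) \Po g = \det N.
  by rewrite -comp_polyA comp_polyZ comp_polyX det_map_mx.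
exists (char_poly G \Po (t ^+ k *: 'X)), (k * s.+1)%N; split.
  rewrite lead_coef_comp ?size_scale ?size_polyX ?expf_neq0 //.
  rewrite (monicP (char_poly_monic G)) size_char_poly lead_coefZ lead_coefX.
  by rewrite mul1r mulr1 -exprM.
rewrite def_h.
(* The entry of index 0 of v is 1, so it isolates the determinant. *)
have : (\det N *: v) 0 0 = (\adj N *m (N *m v)) 0 0.
  by rewrite mulmxA mul_adj_mx mul_scalar_mx.
rewrite def_Nv -scalemxAr 2![in LHS]mxE expr0 mulr1 mxE => ->.
exact: dvdp_mulIl.
Qed.

(** A p-adic statement: a factor with leading coefficient prime to p would make
one root of f integral at p, hence all its roots because f is irreducible,
whereas p divides the leading coefficient of f but not all its coefficients. *)
Lemma lead_coef_dvd_of_comp_factor (K : fieldType) (p : {poly K})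
    (f g B : {poly {poly K}}) :
    irreducible_poly p -> irreducible_poly f ->
    p %| lead_coef f -> ~~ (p %| f`_0) ->
    (1 < size B)%N -> B %| f \Po g ->
  p %| lead_coef B.
Proof.
move=> p_irr f_irr p_lf p_f0 B_gt1 B_fg; apply/negPn/negP => p_lB.
have [h [k [lead_h B_hg]]] := integral_relation g B_gt1.
have p_lh : ~~ (p %| lead_coef h).
  rewrite lead_h; elim: k {lead_h} => [|k IHk].
    by rewrite expr0 dvdp1; case: p_irr => /gtn_eqF->.
  rewrite exprS; apply: contra p_lB => /(irreducible_dvdpM p_irr).
  by rewrite (negPf IHk) orbF.
have f_h : f %| h.
  (* A Bezout relation between f and h, evaluated at g, would make B divide a
     nonzero constant. *)
  have [cop|ncop] := boolP (coprimep f h).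
    have [[u v] /eqpP[[c1 c2] /= /andP[_ c2_0] uv]] :=
      Pdiv.Idomain.Bezout_coprimepP _ _ cop.
    have: B %| c2%:P.
      have -> : c2%:P = c2 *: 1 \Po g by rewrite alg_polyC comp_polyC.
      rewrite -uv comp_polyZ comp_polyD !comp_polyM -mul_polyC dvdp_mull //.
      by rewrite dvdp_add ?dvdp_mull.
    move/dvdp_leq; rewrite polyC_eq0 c2_0 size_polyC c2_0 => /(_ isT).
    by rewrite leqNgt B_gt1.
  rewrite -(eqp_dvdl _ (f_irr.2 _ ncop (dvdp_gcdl f h))).
  exact: dvdp_gcdr.
have [[c u] /= c0 ch] := Pdiv.Idomain.dvdpP _ _ f_h.
have [c1 [c2 [u1 [f1 [_ def_f def_h]]]]] := gauss_factor c0 ch.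
have p_lf1 : ~~ (p %| lead_coef f1).
  by apply: contra p_lh => p_lf1; rewrite def_h lead_coefM dvdp_mull.
move: p_lf; rewrite def_f lead_coefZ => /(irreducible_dvdpM p_irr).
rewrite (negPf p_lf1) orbF => p_c2.
by move: p_f0; rewrite def_f coefZ dvdp_mulr.
Qed.

(** Each nonconstant factor takes a p from the leading coefficient of f(g), so
two of them would require p^2 there. *)
Lemma irreducible_comp (K : fieldType) (p : {poly K}) (f g : {poly {poly K}}) :
    irreducible_poly p -> irreducible_poly f ->
    p %| lead_coef f -> ~~ (p %| f`_0) ->
    (1 < size g)%N -> ~~ (p * p %| lead_coef (f \Po g)) ->
  irreducible_poly (f \Po g).
Proof.
move=> p_irr f_irr p_lf p_f0 g_gt1 pp_lfg.
apply: irreducible_of_no_factor => [|A B def_fg].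
  rewrite -ltn_predRL size_comp_poly.
  case: f_irr => f_gt1 _.
  by move: (size f) (size g) f_gt1 g_gt1 => [|[|x]] [|[|y]].
have [A_le1|A_gt1] := leqP (size A) 1; [by left|right].
rewrite leqNgt; apply: contra pp_lfg => B_gt1; rewrite def_fg lead_coefM.
have p_dvd := lead_coef_dvd_of_comp_factor p_irr f_irr p_lf p_f0.
apply: dvdp_mul; apply: (p_dvd g) => //; rewrite def_fg.
  exact: dvdp_mulIl.
exact: dvdp_mulIr.
Qed.

(** * The irreducibility criterion *)

Theorem corollary4 (K : fieldType) (m n : nat) (hm : (1 <= m)%N)
  (hn : (1 <= n)%N) (f g : {poly {poly K}})
  (hf : (size f <= m.+1)%N) (hg : (size g <= n.+1)%N)
  (hne : f`_0 * f`_m * g`_n != 0)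
  (p q : {poly K}) (hpq : f`_m = p * q) (hp : irreducible_poly p)
  (hdeg : (maxn ((m - 1) * pdeg q)
                ((n - 1) * pdeg q + m * n * pdeg g`_n) + H1 f < pdeg p)%N) :
  irreducible_over_KX (f \Po g).
Proof.
apply: irreducible_over_fractions.
move: hne; rewrite !mulf_eq0 !negb_or => /andP[/andP[f0 fm] gn].
have size_eq (C : {poly {poly K}}) d :
    (size C <= d.+1)%N -> C`_d != 0 -> size C = d.+1.
  move=> le_C Cd; apply/eqP; rewrite eqn_leq le_C ltnNge.
  by apply: contra Cd => /leq_sizeP->.
have size_f := size_eq _ _ hf fm; have size_g := size_eq _ _ hg gn.
have lead_f : lead_coef f = p * q by rewrite lead_coefE size_f.
have lead_g : lead_coef g = g`_n by rewrite lead_coefE size_g.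
have p0 := irredp_neq0 hp.
have q0 : q != 0 by apply: contraNneq fm => q0; rewrite hpq q0 mulr0.
have ndvd_small a : a != 0 -> (pdeg a < pdeg p)%N -> ~~ (p %| a).
  move=> a0; apply: contraL => /(dvdp_leq a0); rewrite /pdeg.
  by move: (size _) (size _) => x y; lia.
have f_irr : irreducible_poly f.
  apply: (irreducible_of_large_lead_coef hp lead_f f0).
    by rewrite size_f.
  apply: leq_ltn_trans hdeg; rewrite size_f leq_add2r; exact: leq_maxl.
(* For m = n = 1 the degree condition does not prevent p from dividing q. *)
have [mn1|mn_gt1] := eqVneq (m * n)%N 1%N.
  have size_fg : size (f \Po g) = 2.
    have fg_gt0 : (0 < size (f \Po g))%N.
      rewrite lt0n; apply/eqP => z; have := size_comp_poly f g.
      by rewrite z size_f size_g /= mn1.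
    have := size_comp_poly f g; rewrite size_f size_g /= mn1.
    by move: (size _) fg_gt0 => [|[|[]]].
  apply: irreducible_of_no_factor => [|A B def_fg]; first by rewrite size_fg.
  have: A * B != 0 by rewrite -def_fg -size_poly_gt0 size_fg.
  rewrite mulf_eq0 negb_or => /andP[A0 B0].
  have := size_mul A0 B0; rewrite -def_fg size_fg.
  by move: (size A) (size B) => x y; lia.
apply: (irreducible_comp hp f_irr); first by rewrite lead_f dvdp_mulIl.
- apply: ndvd_small => //; apply: leq_ltn_trans hdeg.
  rewrite (leq_trans _ (leq_addl _ _)) // /H1 size_f /=.
  by rewrite (bigD1 (Ordinal hm)) //= leq_maxl.
- by rewrite size_g.
rewrite lead_coef_comp ?size_g // lead_f lead_g size_f /= -mulrA dvdp_mul2l //.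
have p_q : ~~ (p %| q).
  apply: ndvd_small => //; apply: leq_ltn_trans hdeg.
  rewrite (leq_trans _ (leq_addr _ _)) // leq_max.
  have [m_gt1|m_le1] := ltnP 1 m; first by rewrite leq_pmull // subn_gt0.
  have m1 : m = 1%N by apply/eqP; rewrite eqn_leq m_le1.
  have n_gt1 : (1 < n)%N.
    by rewrite ltn_neqAle hn eq_sym andbT; move: mn_gt1; rewrite m1 mul1n.
  apply/orP; right; rewrite (leq_trans _ (leq_addr _ _)) //.
  by rewrite leq_pmull // subn_gt0.
have p_gn : ~~ (p %| g`_n).
  apply: ndvd_small => //; apply: leq_ltn_trans hdeg.
  rewrite (leq_trans _ (leq_addr _ _)) // leq_max; apply/orP; right.
  by rewrite (leq_trans _ (leq_addl _ _)) // leq_pmull // muln_gt0 hm.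
apply/negP => /(irreducible_dvdpM hp); rewrite (negPf p_q) /=.
elim: {hf hdeg hpq fm size_f mn_gt1 hm} m => [|k IHk].
  by rewrite expr0 dvdp1; case: hp => /gtn_eqF->.
by rewrite exprS => /(irreducible_dvdpM hp); rewrite (negPf p_gn).
Qed.
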